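(* Let $m,n$ be positive integers with $m\mid n$. Let $f:\mathbb{F}_{2^n}\rightarrow \mathbb{F}_{2^m}$ be an arbitrary mapping, and let $L:\mathbb{F}_{2^n}\rightarrow \mathbb{F}_{2^n}$ be an $\mathbb{F}_{2^m}$-linear permutation of $\mathbb{F}_{2^n}$. Let $g:\mathbb{F}_{2^m}\rightarrow \mathbb{F}_{2^m}$ be a permutation of $\mathbb{F}_{2^m}$. Let $A(x)$ be an additive permutation polynomial over $\mathbb{F}_{2^m}$, let $A^{-1}(x)$ be the compositional inverse of $A(x)$ on $\mathbb{F}_{2^m}$, and let $b\in\mathbb{F}_{2^m}^*$. If $\gamma\in \mathbb{F}_{2^n}^*$ is a $(b,A)$-linear translator of $f$, then $$\phi(x)=L(x)+L(\gamma)\left(g(f(x))+A^{-1}\left(\frac{f(x)}{b}\right)\right)$$ is a permutation polynomial over $\mathbb{F}_{2^n}$ (i.e. $\phi$ permutes $\mathbb{F}_{2^n}$), and its compositional inverse is $$\phi^{-1}(x)=L^{-1}(x)+\gamma A^{-1}\left(\frac{f(L^{-1}(x))}{b}+\frac{g^{-1}\left(A^{-1}\left(\frac{f(L^{-1}(x))}{b}\right)\right)}{b}\right).$$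
   Context: An additive permutation polynomial over $\mathbb{F}_q$ is a polynomial $A(x)\in\mathbb{F}_q[x]$ that is additive, $A(x+y)=A(x)+A(y)$, and induces a permutation of $\mathbb{F}_q$. Let $f:\mathbb{F}_{q^r}\to\mathbb{F}_q$ be a function, $A$ an additive permutation polynomial over $\mathbb{F}_q$, and $b\in\mathbb{F}_q$ fixed. A nonzero element $\gamma\in\mathbb{F}_{q^r}$ is called a $(b,A)$-linear translator of $f$ if $f(x+u\gamma)-f(x)=bA(u)$ for all $x\in\mathbb{F}_{q^r}$ and all $u\in\mathbb{F}_q$. Here $q=2^m$ and $q^r=2^n$. The compositional inverse of a permutation is its inverse map. *)

(* Defs.v *)
From HB Require Import structures.
From mathcomp Require Import all_boot all_order all_algebra all_field.

Set Implicit Arguments.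
Unset Strict Implicit.
Unset Printing Implicit Defensive.

Import GRing.Theory.
Local Open Scope ring_scope.

(* Additivity is that of the induced map on F, which is implied by the        *)
(* polynomial identity A(X + Y) = A(X) + A(Y).                                *)
Definition additive_perm_poly (F : finFieldType) (A : {poly F}) : Prop :=
  (forall x y : F, A.[x + y] = A.[x] + A.[y]) /\
  bijective (fun x : F => A.[x]).

(* K is an extension of F, so the product u * gamma of u in F by gamma in K   *)
(* is the scaling u *: gamma.                                                 *)
Definition linear_translator (F : finFieldType) (K : fieldExtType F)
    (f : K -> F) (b : F) (A : {poly F}) (gamma : K) : Prop :=
  gamma != 0 /\
  forall (x : K) (u : F), f (x + u *: gamma) - f x = b * A.[u].

Definition compositional_inverse (T : Type) (h hinv : T -> T) : Prop :=
  cancel h hinv /\ cancel hinv h.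

(* Main.v *)
Require Import Defs.
From HB Require Import structures.
From mathcomp Require Import all_boot all_order all_algebra all_field.

(** Since [f (x + u *: gamma) = f x + b * A.[u]], a map
    [x |-> x + h (f x) *: gamma], which moves each point along the line
    through it directed by [gamma] by an amount depending only on the value of
    [f], acts on the values of [f] by [t |-> t + b * A.[h t]].  Such a shear is
    therefore undone by another shear [k] as soon as [k], evaluated at the new
    value of [f], gives back the opposite of the displacement [h t]
    ([shear_cancel]): the question moves from [K] to [F].

    By linearity [phi] is [L] after the shear of displacement
    [h t := g t + Ainv (t / b)], and [phi_inv] is a shear of displacement [k]
    after [Linv].  In characteristic 2 the additivity of [A] gives
    [t + b * A.[h t] = t + b * A.[g t] + t = b * A.[g t]]: the term
    [Ainv (t / b)] of [h] is there to kill [t], so that the action on the values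
    of [f] is the permutation [t |-> b * A.[g t]], whose inverse
    [s |-> ginv (Ainv (s / b))] appears in [k].  As opposites are trivial, the
    two displacements cancel each other, and this in both orders. *)

Set Implicit Arguments.
Unset Strict Implicit.
Unset Printing Implicit Defensive.

Import GRing.Theory.
Local Open Scope ring_scope.

Definition shear (F : finFieldType) (K : fieldExtType F) (f : K -> F)
    (gamma : K) (h : F -> F) (x : K) : K :=
  x + h (f x) *: gamma.

(** The translator property evaluates [f] at the sheared point, so that the
    second displacement is known from [f x] alone. *)
Lemma shear_cancel (F : finFieldType) (K : fieldExtType F) (f : K -> F)
    (b : F) (A : {poly F}) (gamma : K) (h k : F -> F) :
  linear_translator f b A gamma ->
  (forall t, k (t + b * A.[h t]) = - h t) ->
  cancel (shear f gamma h) (shear f gamma k).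
Proof.
move=> [_ translP] hkN x; rewrite /shear.
have -> : f (x + h (f x) *: gamma) = f x + b * A.[h (f x)].
  by rewrite -(translP x) [RHS]addrC subrK.
by rewrite hkN scaleNr addrK.
Qed.

Lemma additive_poly_inv (F : finFieldType) (A : {poly F}) (Ainv : F -> F) :
  additive_perm_poly A -> compositional_inverse (fun x : F => A.[x]) Ainv ->
  {morph Ainv : x y / x + y}.
Proof.
move=> [A_add _] [AK AinvK] x y.
by rewrite -[RHS]AK A_add !AinvK.
Qed.

Theorem theorem3p1 (m n : nat) (m_gt0 : (0 < m)%N) (n_gt0 : (0 < n)%N)
    (m_dvd_n : (m %| n)%N)
    (F : finFieldType) (cardF : #|F| = (2 ^ m)%N)
    (K : fieldExtType F) (cardK : #|{: finvect_type K}| = (2 ^ n)%N)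
    (f : K -> F)
    (L : {linear K -> K}) (Linv : K -> K)
    (L_perm : bijective L) (LinvP : compositional_inverse L Linv)
    (g ginv : F -> F)
    (g_perm : bijective g) (ginvP : compositional_inverse g ginv)
    (A : {poly F}) (Ainv : F -> F)
    (A_add_perm : additive_perm_poly A)
    (AinvP : compositional_inverse (fun x : F => A.[x]) Ainv)
    (b : F) (b_neq0 : b != 0)
    (gamma : K) (gamma_neq0 : gamma != 0)
    (gamma_translator : linear_translator f b A gamma) :
  let phi := fun x : K =>
    L x + L gamma * (g (f x) + Ainv (f x / b))%:A in
  let phi_inv := fun x : K =>
    Linv x + gamma * (Ainv (f (Linv x) / b
                            + ginv (Ainv (f (Linv x) / b)) / b))%:A in
  bijective phi /\ compositional_inverse phi phi_inv.
Proof.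
move=> phi phi_inv.
have [LK LinvK] := LinvP; have [gK ginvK] := ginvP.
have [[A_add _] [AK AinvK]] := (A_add_perm, AinvP).
have Ainv_add := additive_poly_inv A_add_perm AinvP.
have char2 : 2 \in [pchar F] by exact: card_finPcharP cardF _.
have addxx (t : F) : t + t = 0 := addrr_pchar2 char2 t.
have oppx (t : F) : - t = t := oppr_pchar2 char2 t.
have mulbK (t : F) : b * (t / b) = t by rewrite mulrC divfK.
have divbK (t : F) : b * t / b = t by rewrite mulrC mulKf.
pose h t := g t + Ainv (t / b).
pose k t := Ainv (t / b + ginv (Ainv (t / b)) / b).
have phiE x : phi x = L (shear f gamma h x).
  by rewrite /phi /shear linearD linearZ /= -scalerAr mulr1.
have phi_invE x : phi_inv x = shear f gamma k (Linv x).
  by rewrite /phi_inv /shear -scalerAr mulr1.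
(* The values of f are permuted by t |-> b * A.[g t] and by its inverse. *)
have actE t : t + b * A.[h t] = b * A.[g t].
  by rewrite A_add AinvK mulrDr mulbK addrCA addxx addr0.
have act_invE t : t + b * A.[k t] = ginv (Ainv (t / b)).
  by rewrite AinvK mulrDr !mulbK addrA addxx add0r.
have hK : cancel (shear f gamma h) (shear f gamma k).
  apply: (shear_cancel gamma_translator) => t.
  by rewrite actE oppx /k divbK AK gK Ainv_add AK.
have kK : cancel (shear f gamma k) (shear f gamma h).
  apply: (shear_cancel gamma_translator) => t.
  by rewrite act_invE oppx /h ginvK /k Ainv_add.
have phiK : cancel phi phi_inv by move=> x; rewrite phi_invE phiE LK hK.
have phi_invK : cancel phi_inv phi by move=> x; rewrite phiE phi_invE kK LinvK.
by split=> //; exists phi_inv.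
Qed.
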